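(* Let $r\in\mathbb{N}$ and let $D=\sum_{k=0}^r d_k(z)\frac{d^k}{dz^k}$ be a linear differential operator of order $r$ with complex polynomial coefficients $d_k(z)\in\mathbb{P}$. Let $\{u_n(z)\}_{n=0}^\infty$, $\deg u_n=n$, be an arbitrary set of complex polynomials. The following statements are equivalent: (A) For each $n\in\mathbb{Z}_+$ the equation $D y(z)=u_n(z)$ has a complex polynomial solution $y(z)=y_n(z)$ of degree $n$; (B) $D z^n$ is a complex polynomial of degree $n$, for all $n\in\mathbb{Z}_+$; (C) The following conditions hold: $$\deg d_k\le k,\qquad 0\le k\le r;$$ $$\sum_{j=0}^r [n]_j\, d_{j,j}\neq 0,\qquad n\in\mathbb{Z}_+,$$ where $d_{j,l}$ denotes the coefficient of $z^l$ in the polynomial $d_j$. If one of the statements (A), (B), (C) holds true, then for each $n\in\mathbb{Z}_+$ the (complex polynomial, degree $n$) solution of $D y(z)=u_n(z)$ is unique.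
   Context: $\mathbb{N}$ is the set of positive integers, $\mathbb{Z}_+$ the set of non-negative integers, and $\mathbb{P}$ the set of all polynomials with complex coefficients. For a complex number $c$: $[c]_0=1$ and $[c]_k=c(c-1)\cdots(c-k+1)$ for $k\in\mathbb{N}$. The zero polynomial is regarded as satisfying any bound of the form $\deg\le k$. *)

(* Defs.v *)
From HB Require Import structures.
From mathcomp Require Import all_boot all_order all_algebra.

Set Implicit Arguments.
Unset Strict Implicit.
Unset Printing Implicit Defensive.

Import Order.TTheory GRing.Theory Num.Theory.
Local Open Scope ring_scope.

(* Since [size 0 = 0], deg p = n is [size p = n.+1], and deg p <= n, which the
   zero polynomial satisfies by convention, is [(size p <= n.+1)%N]. *)

Definition cffact (C : nzRingType) (c : C) (k : nat) : C :=
  \prod_(i < k) (c - i%:R).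

Definition diffop (C : nzRingType) (r : nat) (d : 'I_r.+1 -> {poly C})
    (y : {poly C}) : {poly C} :=
  \sum_(k < r.+1) d k * y^`(k).

Definition condA (C : nzRingType) (r : nat) (d : 'I_r.+1 -> {poly C})
    (u : nat -> {poly C}) : Prop :=
  forall n : nat, exists y : {poly C}, size y = n.+1 /\ diffop d y = u n.

Definition condB (C : nzRingType) (r : nat) (d : 'I_r.+1 -> {poly C}) : Prop :=
  forall n : nat, size (diffop d 'X^n) = n.+1.

Definition condC (C : nzRingType) (r : nat) (d : 'I_r.+1 -> {poly C}) : Prop :=
  (forall k : 'I_r.+1, (size (d k) <= k.+1)%N) /\
  (forall n : nat, \sum_(j < r.+1) cffact (n%:R : C) j * (d j)`_j != 0).

(* Main.v *)
Require Import Defs.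
From HB Require Import structures.
From mathcomp Require Import all_boot all_order all_algebra.
From mathcomp Require Import reals complex.

Set Implicit Arguments.
Unset Strict Implicit.
Unset Printing Implicit Defensive.

Import Order.TTheory GRing.Theory Num.Theory.
Local Open Scope ring_scope.

(** Condition (B) says that, in the monomial basis, the linear map [D] is
    triangular with nonzero diagonal. Such a map preserves the degree of every
    polynomial ([size_linear_degree_preserving]), hence is injective, and it is
    surjective because leading terms can be eliminated one after another
    ([linear_degree_preserving_surj]). This gives (B) => (A) together with
    uniqueness. Conversely, under (A) the solutions [y_n] form another basis
    adapted to the degree filtration, and [D] is triangular with nonzero
    diagonal in it; since [X^n] differs from a nonzero multiple of [y_n] by
    terms of lower degree, triangularity passes to the monomials
    ([size_linear_Xn_of_basis]).

    For (B) <=> (C), [D X^n] is the sum of the [[n]_k d_k X^(n-k)], whose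
    coefficient at [X^n] is exactly the sum in (C) ([coef_diffop_Xn]): the
    diagonal entries of [D] are the numbers required to be nonzero. The bounds
    [deg d_k <= k] make [D] triangular, since the terms with [k > n] vanish.
    They are also forced by triangularity, by strong induction on [k]: in
    [D X^k] all summands of index below [k] already have degree at most [k], so
    the remaining one, [k! d_k], does too, and [k!] is invertible. *)

Lemma size_bigsum_le (C : nzRingType) (I : Type) (s : seq I) (P : pred I)
    (f : I -> {poly C}) (n : nat) :
    (forall i, P i -> (size (f i) <= n)%N) ->
  (size (\sum_(i <- s | P i) f i)%R <= n)%N.
Proof.
move=> le_f; apply: (big_ind (fun p : {poly C} => (size p <= n)%N)) => //.
  by rewrite size_poly0.
by move=> p q le_p le_q; rewrite (leq_trans (size_polyD _ _)) // geq_max le_p.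
Qed.

Lemma coef_top_neq0 (C : nzRingType) (p : {poly C}) (n : nat) :
  size p = n.+1 -> p`_n != 0.
Proof.
move=> sz_p; have -> : p`_n = lead_coef p by rewrite lead_coefE sz_p.
by rewrite lead_coef_eq0 -size_poly_eq0 sz_p.
Qed.

Section DegreePreserving.

Variables (F : fieldType) (L : {linear {poly F} -> {poly F}}).

(** Triangularity is required only below [n], so that the lemma applies inside
    an induction that establishes it. *)
Lemma size_linear_le (n : nat) (p : {poly F}) :
    (forall i, (i < n)%N -> (size (L 'X^i) <= i.+1)%N) ->
  (size p <= n)%N -> (size (L p) <= size p)%N.
Proof.
move=> LX le_pn; rewrite -[in L p](coefK p) poly_def linear_sum.
apply: size_bigsum_le => i _; rewrite linearZ.
apply: leq_trans (size_scale_leq _ _) _.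
exact: leq_trans (LX _ (leq_trans (ltn_ord i) le_pn)) (ltn_ord i).
Qed.

(** One step of leading term elimination: [q], of exact degree [n], cancels
    the coefficient of degree [n] of [p], which may itself be zero. *)
Lemma size_sub_lead (n : nat) (p q : {poly F}) :
    size q = n.+1 -> (size p <= n.+1)%N ->
  (size (p - (p`_n / q`_n) *: q)%R <= n)%N.
Proof.
move=> sz_q sz_p; have qn0 := coef_top_neq0 sz_q.
apply/leq_sizeP => j; rewrite leq_eqVlt => /orP[/eqP <-|lt_nj].
  by rewrite coefB coefZ divfK // subrr.
rewrite coefB coefZ (nth_default _ (leq_trans sz_p lt_nj)).
by rewrite [q`_j]nth_default ?sz_q // mulr0 subrr.
Qed.

(** The coefficient of [y n] in the expansion of [X^n] is nonzero, so the
    leading term of [L (y n)] survives in [L X^n]; by induction the image of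
    the lower order remainder cannot reach degree [n]. *)
Lemma size_linear_Xn_of_basis (y : nat -> {poly F}) :
    (forall n, size (y n) = n.+1) -> (forall n, size (L (y n)) = n.+1) ->
  forall n, size (L 'X^n) = n.+1.
Proof.
move=> sz_y sz_Ly; elim/ltn_ind => n IHn.
set c := 'X^n`_n / (y n)`_n.
have c0 : c != 0.
  by rewrite /c coefXn eqxx mul1r invr_eq0 coef_top_neq0.
have sz_q : (size ('X^n - c *: y n)%R <= n)%N.
  by apply: size_sub_lead; rewrite ?sz_y ?size_polyXn.
rewrite -[X in L X](subrK (c *: y n)) linearD [L (c *: _)]linearZ /=.
have sz_cLy : size (c *: L (y n)) = n.+1 by rewrite size_scale.
rewrite addrC size_polyDl sz_cLy // ltnS (leq_trans _ sz_q) //.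
by apply: (size_linear_le _ sz_q) => i /IHn ->.
Qed.

Hypothesis LXn : forall n, size (L 'X^n) = n.+1.

Lemma size_linear_degree_preserving (p : {poly F}) : size (L p) = size p.
Proof.
have [-> | p0] := eqVneq p 0; first by rewrite linear0.
have [n sz_p] : exists n, size p = n.+1.
  by exists (size p).-1; rewrite prednK // lt0n size_poly_eq0.
set c := p`_n / ('X^n : {poly F})`_n.
have c0 : c != 0.
  by rewrite /c coefXn eqxx divr1 coef_top_neq0.
have sz_q : (size (p - c *: 'X^n)%R <= n)%N.
  by apply: size_sub_lead; rewrite ?size_polyXn ?sz_p.
rewrite -[X in L X](subrK (c *: 'X^n)) linearD [L (c *: _)]linearZ /= sz_p.
have sz_cLX : size (c *: L 'X^n) = n.+1 by rewrite size_scale.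
rewrite addrC size_polyDl sz_cLX // ltnS (leq_trans _ sz_q) //.
by apply: (size_linear_le _ sz_q) => i _; rewrite LXn.
Qed.

Lemma linear_degree_preserving_inj : injective L.
Proof.
move=> p q /eqP; rewrite -subr_eq0 -linearB -size_poly_eq0.
by rewrite size_linear_degree_preserving size_poly_eq0 subr_eq0 => /eqP.
Qed.

(** Since [L X^n] has exact degree [n], a multiple of it removes the top term of
    [v], and the remainder has a preimage by induction on the degree. *)
Lemma linear_degree_preserving_surj (v : {poly F}) : exists y, L y = v.
Proof.
have [n] := ubnP (size v); elim: n v => // n IHn v; rewrite ltnS => sz_v.
case: n => [|n] in IHn sz_v *.
  by exists 0; apply/eqP; rewrite linear0 eq_sym -size_poly_leq0.
have [|y Ly] := IHn (v - (v`_n / (L 'X^n)`_n) *: L 'X^n).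
  by rewrite ltnS size_sub_lead.
exists (y + (v`_n / (L 'X^n)`_n) *: 'X^n).
by rewrite linearD linearZ Ly subrK.
Qed.

End DegreePreserving.

Lemma diffop_is_linear (C : comNzRingType) (r : nat) (d : 'I_r.+1 -> {poly C}) :
  linear (diffop d).
Proof.
move=> a p q; rewrite /diffop scaler_sumr -big_split /=.
by apply: eq_bigr => k _; rewrite linearP mulrDr -scalerAr.
Qed.

HB.instance Definition _ (C : comNzRingType) (r : nat)
    (d : 'I_r.+1 -> {poly C}) :=
  GRing.isLinear.Build C {poly C} {poly C} *:%R (diffop d) (diffop_is_linear d).

Lemma cffact_nat (C : nzRingType) (n k : nat) :
  cffact (n%:R : C) k = (n ^_ k)%:R.
Proof.
elim: k => [|k IHk]; first by rewrite /cffact big_ord0.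
rewrite /cffact big_ord_recr /= -/(cffact _ k) IHk ffactnSr natrM.
have [le_kn | lt_nk] := leqP k n; first by rewrite natrB.
by rewrite ffact_small // !mul0r.
Qed.

Lemma diffop_Xn (C : nzRingType) (r : nat) (d : 'I_r.+1 -> {poly C}) (n : nat) :
  diffop d 'X^n = \sum_(k < r.+1) (d k * 'X^(n - k)) *+ n ^_ k.
Proof. by apply: eq_bigr => k _; rewrite derivnXn mulrnAr. Qed.

(** The coefficient of [X^n] in [d_k X^(n-k)] is that of [X^k] in [d_k], whence
    the diagonal entries of the operator in the monomial basis. For [k > n] the
    truncated exponent [n - k] is harmless because [n ^_ k = 0]. *)
Lemma coef_diffop_Xn (C : nzRingType) (r : nat) (d : 'I_r.+1 -> {poly C})
    (n : nat) :
  (diffop d 'X^n)`_n = \sum_(j < r.+1) cffact (n%:R : C) j * (d j)`_j.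
Proof.
rewrite diffop_Xn coef_sum; apply: eq_bigr => k _.
rewrite cffact_nat mulr_natl coefMn.
have [le_kn | lt_nk] := leqP k n; last by rewrite ffact_small.
by rewrite coefMXn ltnNge leq_subr /= subKn.
Qed.

(** A bound [deg p <= k] makes [p] times the [k]-th derivative not raise the
    degree of monomials; the case [k > n] rests on [n ^_ k = 0] alone. *)
Lemma size_diffop_term (C : nzRingType) (p : {poly C}) (n k : nat) :
  (size p <= k.+1)%N -> (size ((p * 'X^(n - k)) *+ n ^_ k)%R <= n.+1)%N.
Proof.
move=> sz_p; have [le_kn | lt_nk] := leqP k n; last first.
  by rewrite ffact_small // mulr0n size_poly0.
apply/leq_sizeP => j lt_nj; rewrite coefMn coefMXn ltnNge.
rewrite (leq_trans (leq_subr _ _) (ltnW lt_nj)) /= nth_default ?mul0rn //.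
by apply: leq_trans sz_p _; rewrite ltn_subRL subnK.
Qed.

Lemma condC_condB (C : nzRingType) (r : nat) (d : 'I_r.+1 -> {poly C}) :
  condC d -> condB d.
Proof.
move=> [sz_d diag_d] n; apply/eqP; rewrite eqn_leq; apply/andP; split.
  rewrite diffop_Xn; apply: size_bigsum_le => k _.
  exact: size_diffop_term.
rewrite ltnNge; apply/negP => /leq_sizeP/(_ n (leqnn n)).
by rewrite coef_diffop_Xn; apply/eqP.
Qed.

(** The degree bounds come by strong induction on [k]: among the summands of
    [D X^k], those of index above [k] vanish and those of index below [k] are
    controlled by induction, which isolates [k! d_k]. *)
Lemma condB_condC (C : numDomainType) (r : nat) (d : 'I_r.+1 -> {poly C}) :
  condB d -> condC d.
Proof.
move=> sz_DX; split=> [k|n]; last first.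
  by rewrite -coef_diffop_Xn coef_top_neq0.
have [m] := ubnP (val k); elim: m k => // m IHm k; rewrite ltnS => le_km.
have := sz_DX k; rewrite diffop_Xn (bigD1 k) //= subnn expr0 mulr1 ffactnn.
set rest := \sum_(i < r.+1 | _) _ => sz_sum.
have sz_rest : (size rest <= k.+1)%N.
  apply: size_bigsum_le => i ne_ik.
  have [lt_ik | lt_ki | eq_ik] := ltngtP i k.
  - by apply: size_diffop_term; apply: IHm; apply: leq_trans le_km.
  - by rewrite ffact_small // mulr0n size_poly0.
  - by rewrite (val_inj eq_ik) eqxx in ne_ik.
have: (size (d k *+ (k : nat)`!)%R <= k.+1)%N.
  rewrite -[d k *+ _](addrK rest) (leq_trans (size_polyD _ _)) //.
  by rewrite size_polyN geq_max sz_sum leqnn.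
rewrite -scaler_nat -mul_polyC size_Cmul // pnatr_eq0.
by rewrite -lt0n fact_gt0.
Qed.

Theorem proposition1 (R : realType) (r : nat) (r_gt0 : (0 < r)%N)
    (d : 'I_r.+1 -> {poly R[i]}) (d_order : d ord_max != 0)
    (u : nat -> {poly R[i]}) (deg_u : forall n : nat, size (u n) = n.+1) :
  [/\ condA d u <-> condB d,
      condB d <-> condC d
    & condA d u \/ condB d \/ condC d ->
      forall n : nat,
        exists! y : {poly R[i]}, size y = n.+1 /\ diffop d y = u n].
Proof.
have AB : condA d u -> condB d.
  move=> /boolp.choice[y sol_y].
  apply: (@size_linear_Xn_of_basis _ (diffop d) y) => n.
    by have [] := sol_y n.
  by have [_ /= ->] := sol_y n.
have Bsol : condB d -> forall n,
    exists! y : {poly R[i]}, size y = n.+1 /\ diffop d y = u n.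
  move=> dB n; have [y Dy] := linear_degree_preserving_surj dB (u n).
  exists y; split=> [|z [_ Dz]].
    by split=> //; rewrite -(size_linear_degree_preserving dB) Dy.
  by apply: (linear_degree_preserving_inj dB); rewrite /= Dz.
split; first split=> // dB n.
- by have [y [sol_y _]] := Bsol dB n; exists y.
- by split; [exact: condB_condC | exact: condC_condB].
- by case=> [/AB|[|/condC_condB]]; apply: Bsol.
Qed.
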